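(* Let $a,b$ be indeterminates and let $m\geq 0$ be an integer. Define the bivariate Fibonacci polynomials $F_n(a,b)\in\mathbb{Z}[a,b]$ by $F_0(a,b):=0$ and $$F_{n+1}(a,b):=\sum_{k=0}^{\lfloor n/2\rfloor}\binom{n-k}{k}a^{n-2k}(-b)^k\quad(n\geq 0),$$ and define $L_n(a,b)\in\mathbb{Z}[a,b]$ as the unique solution of $x_{n+2}-ax_{n+1}+bx_n=0$ with $x_0=2$, $x_1=a$. Let $$f_{m+1}(x;a,b):=x^{2m+2}+\bigl[bF_m(a,b)-F_{m+2}(a,b)\bigr]x^{m+1}+b^{m+1}\in\mathbb{Z}[a,b][x].$$ Then $$f_{m+1}(x;a,b)=(x^2-ax+b)\left[\sum_{j=0}^{m-1}F_{j+1}(a,b)x^{2m-j}+\sum_{j=0}^{m}b^{m-j}F_{j+1}(a,b)x^{j}\right]=x^{2m+2}-L_{m+1}(a,b)x^{m+1}+b^{m+1}.$$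
   Context: For $m=0$ the first sum $\sum_{j=0}^{-1}$ is empty. *)

(* Defs.v *)
From HB Require Import structures.
From mathcomp Require Import all_boot all_order all_algebra.
From mathcomp Require Import mpoly.

Set Implicit Arguments.
Unset Strict Implicit.
Unset Printing Implicit Defensive.

Import GRing.Theory.
Local Open Scope ring_scope.

Notation Zab := {mpoly int[2]}.

Definition a : Zab := 'X_ord0.
Definition b : Zab := 'X_ord_max.

Definition F (n : nat) : Zab :=
  if n is n'.+1
  then \sum_(0 <= k < (n' %/ 2).+1)
         'C(n' - k, k)%:R * a ^+ (n' - 2 * k) * (- b) ^+ k
  else 0.

Definition lucas_spec (x : nat -> Zab) : Prop :=
  [/\ x 0%N = 2%:R, x 1%N = a & forall n, x n.+2 - a * x n.+1 + b * x n = 0].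

Fixpoint L (n : nat) : Zab :=
  match n with
  | 0 => 2%:R
  | n'.+1 => match n' with
             | 0 => a
             | n''.+1 => a * L n' - b * L n''
             end
  end.

Lemma L_spec : lucas_spec L.
Proof. by split=> // n /=; rewrite addrAC subrK addrN. Qed.

Lemma L_unique (x : nat -> Zab) : lucas_spec x -> x =1 L.
Proof.
case=> x0 x1 xS n.
suff: x n = L n /\ x n.+1 = L n.+1 by case.
elim: n => [|n [IH0 IH1]] //; split=> //.
have := xS n; rewrite IH0 IH1 -addrA => /eqP.
by rewrite addr_eq0 => /eqP ->; rewrite opprD opprK.
Qed.

(* Indexed by m rather than m + 1: [fS m] is f_(m+1)(x; a, b) in Z[a,b][x]. *)
Definition fS (m : nat) : {poly Zab} :=
  'X^(2 * m + 2) + (b * F m - F m.+2)%:P * 'X^(m.+1) + (b ^+ m.+1)%:P.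

(* Main.v *)
(* Multiplying either sum by x^2 - a x + b telescopes, because
   F_(n+2) = a F_(n+1) - b F_n. The two boundary contributions
   F_(m+1) x^(m+2) cancel, leaving the middle coefficient b F_m - F_(m+2),
   which is - L_(m+1) since both sides satisfy the same recurrence. *)

Require Import Defs.
From HB Require Import structures.
From mathcomp Require Import all_boot all_order all_algebra.
From mathcomp Require Import mpoly ring zify.

Set Implicit Arguments.
Unset Strict Implicit.
Unset Printing Implicit Defensive.

Import GRing.Theory.
Local Open Scope ring_scope.

(* The terms with n < 2 k vanish, since then n - k < k even for truncated
   subtraction; hence the upper bound of the sum may be relaxed. *)
Lemma F_widen (n M : nat) : (n %/ 2 < M)%N ->
  F n.+1 = \sum_(0 <= k < M) 'C(n - k, k)%:R * a ^+ (n - 2 * k) * (- b) ^+ k.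
Proof.
move=> ltM; rewrite /F (big_cat_nat (leq0n _) ltM) /= [X in _ = _ + X]big_nat.
rewrite [X in _ = _ + X]big1 ?addr0 // => k /andP[lek _].
by rewrite bin_small ?mul0r //; lia.
Qed.

Lemma F1 : F 1 = 1.
Proof. by rewrite /F big_nat1 bin0 !expr0 !mulr1. Qed.

(** Pascal's rule applied to each coefficient, with the index shifted by one in the [b] term. *)
Lemma F_rec (n : nat) : F n.+2 = a * F n.+1 - b * F n.
Proof.
case: n => [|n].
  by rewrite F1 /F big_nat1 bin0 expr1 expr0 mul1r mulr1 mulr0 subr0.
(* These bounds make all three sums run over [j < n.+1] once the [k = 0] terms of the first two are
   split off. *)
rewrite (F_widen (M := n.+2) (n := n.+2)); last by lia.
rewrite (F_widen (M := n.+2) (n := n.+1)); last by lia.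
rewrite (F_widen (M := n.+1) (n := n)); last by lia.
rewrite [LHS]big_nat_recl // [in X in _ = a * X - _]big_nat_recl //.
rewrite mulrDr -addrA !bin0 !expr0 !mulr1 !mul1r !muln0 !subn0 -exprS.
congr (_ + _); rewrite !mulr_sumr -sumrB; apply: eq_big_nat => j /andP[_ lejn].
have -> : (n.+2 - j.+1 = (n - j).+1)%N by lia.
have -> : (n.+1 - j.+1 = n - j)%N by lia.
have -> : (n.+2 - 2 * j.+1 = n - 2 * j)%N by lia.
rewrite binS natrD exprS.
(* If [n <= 2 * j], the exponent [n.+1 - 2 * j.+1] truncates to 0 and the powers of [a] no longer
   match, but then ['C(n - j, j.+1)] vanishes. *)
have [le2j|lt2j] := leqP j.*2.+1 n.
  have -> : (n - 2 * j = (n.+1 - 2 * j.+1).+1)%N by lia.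
  by rewrite exprS; ring.
by rewrite (@bin_small _ j.+1); [ring | lia].
Qed.

Lemma L_F (n : nat) : L n.+1 = F n.+2 - b * F n.
Proof.
suff: L n.+1 = F n.+2 - b * F n /\ L n.+2 = F n.+3 - b * F n.+1 by case.
elim: n => [|n [IH0 IH1]].
  by rewrite !F_rec F1 /=; split; ring.
split=> //; have -> : L n.+3 = a * L n.+2 - b * L n.+1 by [].
by rewrite IH0 IH1 (F_rec n.+2) (F_rec n.+1) (F_rec n); ring.
Qed.

(** Keeping [N] apart from [m] leaves the exponents fixed during the induction on [m]; the theorem
    takes [N = 2 * m]. The bound on [m] keeps every subtraction in the exponents from truncating. *)
Lemma mul_sum_F_falling (N m : nat) : (m <= N.+1)%N ->
  ('X^2 - a%:P * 'X + b%:P) * (\sum_(0 <= j < m) (F j.+1)%:P * 'X^(N - j)) =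
  'X^(N.+2) - (F m.+1)%:P * 'X^(N.+2 - m) + (b * F m)%:P * 'X^(N.+1 - m).
Proof.
elim: m => [_|m IH ltmN].
  by rewrite big_nil F1 !subn0 mulr0 mulr0 mul1r subrr mul0r addr0.
rewrite big_nat_recr // mulrDr IH; last exact: ltnW.
have -> : (N.+2 - m = (N - m).+2)%N by lia.
have -> : (N.+1 - m = (N - m).+1)%N by lia.
have -> : (N.+2 - m.+1 = (N - m).+1)%N by lia.
rewrite subSS (F_rec m) polyCB !polyCM !exprS expr0.
by ring.
Qed.

Lemma mul_sum_F_rising (m : nat) :
  ('X^2 - a%:P * 'X + b%:P) *
    (\sum_(0 <= j < m.+1) (b ^+ (m - j) * F j.+1)%:P * 'X^j) =
  (F m.+1)%:P * 'X^(m.+2) - (F m.+2)%:P * 'X^(m.+1) + (b ^+ m.+1)%:P.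
Proof.
elim: m => [|m IH].
  by rewrite big_nat1 F_rec F1 mulr0 subr0 subnn !expr0 !mulr1 mul1r !expr1.
rewrite big_nat_recr; last exact: leq0n.
rewrite subnn expr0 mul1r mulrDr.
(* Raising [m] by one multiplies every earlier coefficient by [b], so the old sum reappears as a
   factor and the induction hypothesis applies. *)
have -> : \sum_(0 <= j < m.+1) (b ^+ (m.+1 - j) * F j.+1)%:P * 'X^j =
          b%:P * \sum_(0 <= j < m.+1) (b ^+ (m - j) * F j.+1)%:P * 'X^j.
  rewrite mulr_sumr; apply: eq_big_nat => j /andP[_ lejm].
  by rewrite subSn // exprS -mulrA polyCM mulrA.
rewrite mulrCA IH (F_rec m.+1) polyCB (exprS b m.+1) !polyCM !exprS.
by ring.
Qed.

Theorem theorem1p2 (m : nat) :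
  fS m =
    ('X^2 - a%:P * 'X + b%:P) *
    (\sum_(0 <= j < m) (F j.+1)%:P * 'X^(2 * m - j) +
     \sum_(0 <= j < m.+1) (b ^+ (m - j) * F j.+1)%:P * 'X^j)
  /\
    ('X^2 - a%:P * 'X + b%:P) *
    (\sum_(0 <= j < m) (F j.+1)%:P * 'X^(2 * m - j) +
     \sum_(0 <= j < m.+1) (b ^+ (m - j) * F j.+1)%:P * 'X^j) =
    'X^(2 * m + 2) - (L m.+1)%:P * 'X^(m.+1) + (b ^+ m.+1)%:P.
Proof.
have mulE : ('X^2 - a%:P * 'X + b%:P) *
    (\sum_(0 <= j < m) (F j.+1)%:P * 'X^(2 * m - j) +
     \sum_(0 <= j < m.+1) (b ^+ (m - j) * F j.+1)%:P * 'X^j) = fS m.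
  rewrite mulrDr mul_sum_F_rising mul_sum_F_falling; last by lia.
  have -> : ((2 * m).+2 - m = m.+2)%N by lia.
  have -> : ((2 * m).+1 - m = m.+1)%N by lia.
  rewrite /fS addn2 polyCB.
  by ring.
by split; rewrite mulE // /fS L_F -[in LHS]opprB polyCN mulNr.
Qed.
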